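(* For every nonnegative integer $n$, $$pod(n)=\sum_{j=0}^{\infty}(-1)^j\,pod(j)\,\overline{p}_o(n-j).$$
   Context: $pod(n)$ denotes the number of partitions of $n$ in which odd parts are distinct and even parts may be repeated, with $pod(0)=1$. An overpartition of $n$ is a non-increasing sequence of positive integers with sum $n$ in which the first occurrence of each number may be overlined; $\overline{p}_o(n)$ is the number of overpartitions of $n$ into odd parts, with $\overline{p}_o(0)=1$ and $\overline{p}_o(m)=0$ for $m<0$. *)

(* Defs.v *)
From mathcomp Require Export all_boot all_order all_algebra.
From mathcomp Require Export classical_sets cardinality fsbigop.

Set Implicit Arguments.
Unset Strict Implicit.
Unset Printing Implicit Defensive.

(* [geq] is the non-strict relation, so equal consecutive parts are allowed. *)
Definition is_partition (n : nat) (s : seq nat) : bool :=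
  [&& sorted geq s, 0 \notin s & sumn s == n].

Definition is_pod_partition (n : nat) (s : seq nat) : bool :=
  is_partition n s && uniq [seq x <- s | odd x].

(* An overpartition is the sequence of its parts, each with a flag telling
   whether that occurrence is overlined. *)
Definition is_overpartition (n : nat) (s : seq (nat * bool)) : bool :=
  is_partition n (unzip1 s) &&
  [forall i : 'I_(size s),
     (nth (0, false) s i).2 ==> (index (nth (0, false) s i).1 (unzip1 s) == i)].

Definition is_odd_overpartition (n : nat) (s : seq (nat * bool)) : bool :=
  is_overpartition n s && all odd (unzip1 s).

(* A partition of n has at most n parts, each at most n; hence the counts below
   over the finite types of sequences of length at most n with parts in 'I_n.+1
   miss nothing, see pod_partition_bounded and odd_overpartition_bounded. *)
Definition seq_of_bseq (n : nat) (s : n.-bseq 'I_n.+1) : seq nat :=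
  [seq val x | x <- s].

Definition flagged_seq_of_bseq (n : nat) (s : n.-bseq ('I_n.+1 * bool)) :
    seq (nat * bool) :=
  [seq (val x.1, x.2) | x <- s].

Definition pod (n : nat) : nat :=
  #|[set s : n.-bseq 'I_n.+1 | is_pod_partition n (seq_of_bseq s)]|.

Definition odd_overpartitions (n : nat) : nat :=
  #|[set s : n.-bseq ('I_n.+1 * bool) |
      is_odd_overpartition n (flagged_seq_of_bseq s)]|.

Definition po_bar (m : int) : nat :=
  match m with
  | Posz n => odd_overpartitions n
  | Negz _ => 0
  end.

Lemma is_partition_size n s : is_partition n s -> size s <= n.
Proof.
case/and3P => _ s_gt0 /eqP <-; elim: s s_gt0 => //= x s IHs.
rewrite inE negb_or eq_sym -lt0n => /andP[x_gt0 /IHs le_s].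
by rewrite -add1n leq_add.
Qed.

Lemma is_partition_part n s x : is_partition n s -> x \in s -> x <= n.
Proof.
case/and3P => _ _ /eqP <-; elim: s => //= y s IHs.
rewrite inE => /orP[/eqP-> | /IHs le_x]; first exact: leq_addr.
exact: leq_trans le_x (leq_addl _ _).
Qed.

Lemma seq_of_bseq_inj n : injective (@seq_of_bseq n).
Proof. by move=> s t /(inj_map val_inj) /val_inj. Qed.

Lemma flagged_seq_of_bseq_inj n : injective (@flagged_seq_of_bseq n).
Proof.
move=> s t /inj_map eq_st; apply/val_inj/eq_st.
by case=> [i b] [j c] [/val_inj-> ->].
Qed.

Lemma pod_partition_bounded n s :
  is_pod_partition n s -> exists t : n.-bseq 'I_n.+1, seq_of_bseq t = s.
Proof.
case/andP => s_part _.
have le_sz : size [seq inord x : 'I_n.+1 | x <- s] <= n.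
  by rewrite size_map; exact: is_partition_size.
exists (Bseq le_sz); rewrite /seq_of_bseq /= -map_comp.
rewrite -[RHS]map_id; apply/eq_in_map => x s_x /=.
by rewrite inordK // ltnS; exact: is_partition_part s_x.
Qed.

Lemma odd_overpartition_bounded n s :
  is_odd_overpartition n s ->
  exists t : n.-bseq ('I_n.+1 * bool), flagged_seq_of_bseq t = s.
Proof.
case/andP => /andP[s_part _] _.
have le_sz : size [seq (inord x.1 : 'I_n.+1, x.2) | x <- s] <= n.
  by rewrite size_map -(size_map fst); exact: is_partition_size.
exists (Bseq le_sz); rewrite /flagged_seq_of_bseq /= -map_comp.
rewrite -[RHS]map_id; apply/eq_in_map => -[x b] s_x /=.
rewrite inordK // ltnS; apply: is_partition_part s_part _.
by apply/mapP; exists (x, b).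
Qed.

(* A finitely supported sum [\sum_(j \in A) F j] is 0 by convention when the
   support is infinite; the support of the summands at hand is always finite. *)
Lemma pod_sum_support_finite (n : nat) :
  finite_set (fun j : nat =>
    ((-1) ^+ j * (pod j)%:Z * (po_bar (n%:Z - j%:Z))%:Z != 0)%R).
Proof.
apply: (@sub_finite_set _ _ (fun j => j < n.+1)); last exact: finite_II.
move=> j /=; apply: contraR; rewrite -leqNgt => lt_nj.
have [k ->] : exists k, (n%:Z - j%:Z)%R = Negz k.
  exists (j - n).-1; rewrite NegzE prednK ?subn_gt0 //.
  by rewrite -subzn ?(ltnW lt_nj) // GRing.opprB.
by rewrite GRing.mulr0.
Qed.

(* Main.v *)
Require Import Defs.
From mathcomp Require Import all_boot all_order all_algebra.
From mathcomp Require Import classical_sets fsbigop.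
From mathcomp Require Import zify ring.

(** Let A_k, C_k be the generating functions of the pod-partitions and of the
   odd overpartitions with all parts at most k, and T_k that of the odd
   overpartitions with parts at most k in which k is not overlined. Removing a
   largest part gives, for odd k,
     A_k = (1 + q^k) A_(k-1),  C_k = (1 + q^k) T_k,  (1 - q^k) T_k = C_(k-1),
   and (1 - q^k) A_k = A_(k-1), C_k = C_(k-1) for even k > 0. Hence
   A_k(q) = A_k(-q) C_k(q) by induction on k, and k = n gives the theorem. *)

Set Implicit Arguments.
Unset Strict Implicit.
Unset Printing Implicit Defensive.

Local Open Scope nat_scope.

(** * Counting by duplicate-free lists *)

Definition has_card (T : eqType) (Q : pred T) (c : nat) : Prop :=
  exists L : seq T, [/\ uniq L, L =i Q & size L = c].

Lemma has_card_inj (T : eqType) (Q : pred T) c d :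
  has_card Q c -> has_card Q d -> c = d.
Proof.
move=> [L [uL LQ <-]] [M [uM MQ <-]].
by apply/perm_size/uniq_perm => // x; rewrite LQ MQ.
Qed.

Lemma eq_has_card (T : eqType) (Q Q' : pred T) c :
  Q =1 Q' -> has_card Q c -> has_card Q' c.
Proof.
move=> eqQ [L [uL LQ sL]]; exists L; split => // x.
by rewrite LQ -!topredE /= eqQ.
Qed.

(** The recurrences compare counts at different [n], hence over different finite types. Transport
    along [g] brings them all into one type of sequences. *)
Lemma has_card_image (F : finType) (T : eqType) (g : F -> T) (Q : pred T) :
    injective g -> (forall x, Q x -> exists t, g t = x) ->
  has_card Q #|[set t | Q (g t)]%SET|.
Proof.
move=> g_inj gQ; exists [seq g t | t <- enum [set t | Q (g t)]%SET].
split; last by rewrite size_map -cardE.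
  by rewrite map_inj_uniq ?enum_uniq.
move=> x; rewrite -[RHS]topredE /=; apply/mapP/idP => [[t]|Qx].
  by rewrite mem_enum inE => Qt ->.
by have [t gt] := gQ x Qx; exists t; rewrite // mem_enum inE gt.
Qed.

(** Covers a removed part that exceeds [n]: the truncated [n - x] would be 0, and the empty sequence
    would be counted wrongly. *)
Lemma has_card_guard (T : eqType) (b : bool) (Q : pred T) c :
  has_card Q c -> has_card (fun x => b && Q x) (if b then c else 0).
Proof. by case: b => // _; exists [::]; split. Qed.

(** Each recurrence is an instance: [Q2] describes what is left after a head [a] is removed, and
    [Q1] the sequences without that head. *)
Lemma has_card_cons (T : eqType) (a : T) (Q Q1 Q2 : pred (seq T)) c1 c2 :
    Q [::] = Q1 [::] ->
    (forall x s, Q (x :: s) = Q1 (x :: s) || (x == a) && Q2 s) ->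
    (forall s, Q2 s -> ~~ Q1 (a :: s)) ->
  has_card Q1 c1 -> has_card Q2 c2 -> has_card Q (c1 + c2).
Proof.
move=> Q0 Qc dis [L [uL LQ <-]] [M [uM MQ <-]].
have LE x : (x \in L) = Q1 x by rewrite LQ -topredE.
have ME x : (x \in M) = Q2 x by rewrite MQ -topredE.
exists (L ++ map (cons a) M); split; last by rewrite size_cat size_map.
  rewrite cat_uniq uL map_inj_uniq ?uM; last by move=> s t [].
  rewrite andbT; apply/hasPn => s /mapP[t]; rewrite ME => Q2t ->.
  by rewrite LE dis.
move=> s; rewrite mem_cat LE -[RHS]topredE /=.
case: s => [|x s]; last rewrite Qc.
  by rewrite Q0; case: (Q1 _) => //=; apply/negbTE/mapP => -[].
congr orb; apply/mapP/andP => [[t Mt [-> ->]]|[/eqP-> Q2s]].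
  by rewrite eqxx -ME.
by exists s; rewrite ?ME.
Qed.

(** * Recurrence for pod-partitions with bounded parts *)

Lemma sorted_geq_cons x s :
  sorted geq (x :: s) = all (leq^~ x) s && sorted geq s.
Proof.
by rewrite /= path_sortedE // => a b c /= ba cb; exact: leq_trans cb ba.
Qed.

Definition pod_part_le (k n : nat) (s : seq nat) : bool :=
  is_pod_partition n s && all (leq^~ k) s.

Lemma pod_part_le_nil k n : pod_part_le k n [::] = (n == 0).
Proof. by rewrite /pod_part_le /is_pod_partition /is_partition /= !andbT eq_sym. Qed.

(** Parts after the head are at most [x]. An odd [x] cannot recur, so there the bound drops to
    [x.-1]; in this way distinctness of odd parts becomes a bound on the tail. *)
Lemma pod_part_le_cons k n x s :
  pod_part_le k n (x :: s) =
  [&& 0 < x, x <= k, x <= n &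
      pod_part_le (if odd x then x.-1 else x) (n - x) s].
Proof.
rewrite /pod_part_le /is_pod_partition /is_partition sorted_geq_cons.
rewrite inE negb_or [0 == x]eq_sym -lt0n.
have -> : (sumn (x :: s) == n) = (x <= n) && (sumn s == n - x).
  by rewrite /=; apply/idP/idP; lia.
case: (posnP x) => [->|x_gt0]; first by rewrite !(andbF, andFb).
have le_tr : all (leq^~ x) s -> x <= k -> all (leq^~ k) s.
  by move=> /allP sx xk; apply/allP => y /sx /leq_trans; apply.
have -> : uniq [seq y <- x :: s | odd y] =
    (odd x ==> (x \notin s)) && uniq [seq y <- s | odd y].
  by rewrite /=; case: ifP => //= xo; rewrite mem_filter xo.
have -> : all (leq^~ (if odd x then x.-1 else x)) s =
    all (leq^~ x) s && (odd x ==> (x \notin s)).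
  case: ifP => _; last by rewrite andbT.
  elim: s {le_tr} => //= y s ->; rewrite inE negb_or.
  have -> : (y <= x.-1) = (y <= x) && (x != y) by lia.
  case: (y <= x); case: (all _ s); case: (x == y); case: (x \in s) => //.
rewrite /=; move: le_tr.
case: (leqP x k) => //=; last by rewrite !andbF.
move=> _; case: (all _ s) => /= [/(_ isT isT) -> | _]; rewrite ?andbF //.
rewrite !andbT /=.
case: (sorted geq s); case: (0 \notin s); case: (x <= n); rewrite ?andbF //=.
by rewrite andbCA andbC.
Qed.

Definition pod_le (k n : nat) : nat :=
  #|[set s : n.-bseq 'I_n.+1 | pod_part_le k n (seq_of_bseq s)]%SET|.

Lemma has_card_pod_le k n : has_card (pod_part_le k n) (pod_le k n).
Proof.
apply: has_card_image; first exact: seq_of_bseq_inj.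
by move=> s /andP[/pod_partition_bounded].
Qed.

Lemma pod_le_pod k n : n <= k -> pod_le k n = pod n.
Proof.
move=> le_nk; apply: eq_card => s; rewrite !inE /pod_part_le.
case: (boolP (is_pod_partition _ _)) => //= /andP[sP _].
by apply/allP => x /(is_partition_part sP) /leq_trans; apply.
Qed.

Lemma pod_le0 n : pod_le 0 n = (n == 0).
Proof.
apply: has_card_inj (has_card_pod_le 0 n) _.
exists (if n == 0 then [:: [::]] else [::]); split; try by case: (n == 0).
move=> s; rewrite -[RHS]topredE /=; case: s => [|x s].
  by rewrite pod_part_le_nil; case: (n == 0).
by rewrite pod_part_le_cons leqn0; case: (n == 0); case: (x).
Qed.

(** Splits on whether the largest part is [k.+1]. Once it is removed, it may occur again exactly
    when it is even, that is, when [k] is odd. *)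
Lemma pod_leS k n :
  pod_le k.+1 n =
  pod_le k n +
  if k < n then pod_le (if odd k then k.+1 else k) (n - k.+1) else 0.
Proof.
apply: has_card_inj (has_card_pod_le _ _) _.
apply: (has_card_cons (a := k.+1)) (has_card_pod_le _ _)
  (has_card_guard _ (has_card_pod_le _ _)) => [|x s|s _].
- by rewrite !pod_part_le_nil.
- rewrite !pod_part_le_cons [x <= k.+1]leq_eqVlt ltnS; case: eqVneq => [->|_] /=.
    by rewrite ltnn; case: (odd k).
  by rewrite orbF.
- by rewrite pod_part_le_cons ltnn andbF.
Qed.

(** * Recurrences for odd overpartitions with bounded parts *)

Definition overpart_le (k n : nat) (s : seq (nat * bool)) : bool :=
  is_odd_overpartition n s && all (leq^~ k) (unzip1 s).

(** The objects counted by T_k. For odd [k] they are also what may follow a head [k], because a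
    later copy of [k] is not its first occurrence. *)
Definition overpart_plain_le (k n : nat) (s : seq (nat * bool)) : bool :=
  overpart_le k n s && ((k, true) \notin s).

Lemma overpart_le_nil k n : overpart_le k n [::] = (n == 0).
Proof.
rewrite /overpart_le /is_odd_overpartition /is_overpartition /is_partition /=.
by rewrite !andbT eq_sym; case: (n == 0) => //=; apply/forallP => -[].
Qed.

Definition overlines_first (s : seq (nat * bool)) : bool :=
  [forall i : 'I_(size s),
     (nth (0, false) s i).2 ==> (index (nth (0, false) s i).1 (unzip1 s) == i)].

(** The head is always a first occurrence, so [b] is free. In the tail, indices of values other than
    [x] all shift by one, while a copy of [x] gets index 0 and cannot be overlined. *)
Lemma overlines_first_cons x b s :
  overlines_first ((x, b) :: s) = ((x, true) \notin s) && overlines_first s.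
Proof.
apply/forallP/andP => [H|[xs /forallP H] [[|i] ltis]]; last 2 first.
- by rewrite /= eqxx implybT.
- move: (ltis) => /=; rewrite ltnS => lti; have /= := H (Ordinal lti).
  case E: (nth _ s i) => [y c] /=; case: c E => //= E.
  case: (eqVneq x y) => [xy|_ /eqP->]; last by rewrite eqxx.
  by case/negP: xs; rewrite xy -E mem_nth.
split.
  apply/negP => /(nthP (0, false)) [i lti E].
  by have := H (@Ordinal (size ((x, b) :: s)) i.+1 lti); rewrite /= E /= eqxx.
apply/forallP => -[i lti].
have := H (@Ordinal (size ((x, b) :: s)) i.+1 lti) => /=.
by case: (_.2) => //=; case: ifP.
Qed.

Lemma overpart_le_cons k n x b s :
  overpart_le k n ((x, b) :: s) =
  [&& odd x, x <= k, x <= n & overpart_plain_le x (n - x) s].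
Proof.
rewrite /overpart_plain_le /overpart_le /is_odd_overpartition /is_overpartition.
rewrite -!/(overlines_first _) overlines_first_cons /is_partition.
rewrite [unzip1 _]/= sorted_geq_cons inE negb_or [0 == x]eq_sym -lt0n.
have -> : (sumn (x :: unzip1 s) == n) = (x <= n) && (sumn (unzip1 s) == n - x).
  by rewrite /=; apply/idP/idP; lia.
rewrite /=; case xo: (odd x); last by rewrite !(andbF, andFb).
have -> : 0 < x by case: x xo.
case: (leqP x k) => [xk|]; last by rewrite !(andbF, andFb).
have le_tr : all (leq^~ x) (unzip1 s) -> all (leq^~ k) (unzip1 s).
  by move=> /allP sx; apply/allP => y /sx /leq_trans; apply.
case: (all (leq^~ x) _) le_tr => /= [/(_ isT) ->|_]; last by rewrite !andbF.
rewrite !andbT.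
case: (sorted geq _); case: (0 \notin _); case: (x <= n); rewrite ?andbF //=.
by case: (_ == _); case: (_ \notin _); case: (overlines_first _); case: (all _ _).
Qed.

Lemma overpart_plain_le_nil k n : overpart_plain_le k n [::] = (n == 0).
Proof. by rewrite /overpart_plain_le overpart_le_nil andbT. Qed.

Definition over_le (k n : nat) : nat :=
  #|[set s : n.-bseq ('I_n.+1 * bool) |
      overpart_le k n (flagged_seq_of_bseq s)]%SET|.

Definition over_plain_le (k n : nat) : nat :=
  #|[set s : n.-bseq ('I_n.+1 * bool) |
      overpart_plain_le k n (flagged_seq_of_bseq s)]%SET|.

Lemma has_card_over_le k n : has_card (overpart_le k n) (over_le k n).
Proof.
apply: has_card_image; first exact: flagged_seq_of_bseq_inj.
by move=> s /andP[/odd_overpartition_bounded].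
Qed.

Lemma has_card_over_plain_le k n :
  has_card (overpart_plain_le k n) (over_plain_le k n).
Proof.
apply: has_card_image; first exact: flagged_seq_of_bseq_inj.
by move=> s /andP[/andP[/odd_overpartition_bounded]].
Qed.

Lemma over_le_over k n : n <= k -> over_le k n = odd_overpartitions n.
Proof.
move=> le_nk; apply: eq_card => s; rewrite !inE /overpart_le.
case: (boolP (is_odd_overpartition _ _)) => //= /andP[/andP[sP _] _].
by apply/allP => x /(is_partition_part sP) /leq_trans; apply.
Qed.

Lemma over_le0 n : over_le 0 n = (n == 0).
Proof.
apply: has_card_inj (has_card_over_le 0 n) _.
exists (if n == 0 then [:: [::]] else [::]); split; try by case: (n == 0).
move=> s; rewrite -[RHS]topredE /=; case: s => [|[x b] s].
  by rewrite overpart_le_nil; case: (n == 0).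
rewrite overpart_le_cons leqn0; case: (n == 0); case: x => //= x.
  by rewrite andbF.
by rewrite andbF.
Qed.

Lemma over_leS_even k n : odd k -> over_le k.+1 n = over_le k n.
Proof.
move=> ko; apply: has_card_inj (has_card_over_le _ _) _.
apply: eq_has_card (has_card_over_le _ _) => -[|[x b] s].
  by rewrite !overpart_le_nil.
rewrite !overpart_le_cons [x <= k.+1]leq_eqVlt ltnS.
by case: eqVneq => // ->; rewrite /= ko.
Qed.

(** An overlined [k] is the first copy of the largest possible part, so it stands at the head. This
    gives C_k = (1 + q^k) T_k. *)
Lemma over_le_odd k n : odd k ->
  over_le k n =
  over_plain_le k n + if k <= n then over_plain_le k (n - k) else 0.
Proof.
move=> ko; apply: has_card_inj (has_card_over_le _ _) _.
apply: (has_card_cons (a := (k, true))) (has_card_over_plain_le _ _)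
  (has_card_guard _ (has_card_over_plain_le _ _)) => [|[x b] s|s _].
- by rewrite overpart_plain_le_nil overpart_le_nil.
- rewrite [in RHS]/overpart_plain_le inE negb_or [_ == (k, true)]eq_sym.
  case: eqVneq => [[<- <-]|nE] /=.
    by rewrite andbF /= overpart_le_cons ko leqnn.
  rewrite orbF; case: (boolP (overpart_le _ _ _)) => //=.
  rewrite overpart_le_cons => /and4P[_ xk _ /andP[/andP[_ /allP sx] xs]].
  (* An overlined [k] in the tail forces the head [x] to equal [k], so that it is not the first
     copy. *)
  apply/esym/negP => ks; have kx : k <= x by apply/sx/mapP; exists (k, true).
  have E : x = k by apply/eqP; rewrite eqn_leq xk.
  by rewrite E ks in xs.
- by rewrite /overpart_plain_le inE eqxx andbF.
Qed.

(** Either [k.+1] does not occur, or the head is a plain [k.+1], whose removal leaves an object of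
    the same kind: T = C_k + q^(k+1) T for T = T_(k+1). *)
Lemma over_plain_leS k n : ~~ odd k ->
  over_plain_le k.+1 n =
  over_le k n + if k < n then over_plain_le k.+1 (n - k.+1) else 0.
Proof.
move=> ko; apply: has_card_inj (has_card_over_plain_le _ _) _.
apply: (has_card_cons (a := (k.+1, false))) (has_card_over_le _ _)
  (has_card_guard _ (has_card_over_plain_le _ _)) => [|[x b] s|s _].
- by rewrite overpart_plain_le_nil overpart_le_nil.
- rewrite {1}/overpart_plain_le inE negb_or !overpart_le_cons !xpair_eqE.
  rewrite [x <= k.+1]leq_eqVlt ltnS [k.+1 == x]eq_sym.
  case: eqVneq => [->|_] /=.
    rewrite ltnn (negbTE ko) andbF /=; case: b; rewrite ?andbF //=.
    by rewrite /overpart_plain_le; case: (_ \notin s); rewrite ?andbF ?andbT.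
  rewrite orbF; case: (odd x) => //=; case: (leqP x k) => //= xk.
  case: (x <= n) => //=; case: (boolP (overpart_plain_le _ _ _)) => //=.
  move=> /andP[/andP[_ /allP sx] _]; apply/negP => ks.
  have kx : k.+1 <= x by apply/sx/mapP; exists (k.+1, true).
  by move: (leq_trans kx xk); rewrite ltnn.
- by rewrite overpart_le_cons ltnn andbF.
Qed.

(** * Power series as coefficient sequences *)

Import GRing.Theory.
Local Open Scope ring_scope.

Section Convolution.

Variable R : comNzRingType.
Implicit Types f g : nat -> R.

Definition conv f g (n : nat) : R := \sum_(i < n.+1) f i * g (n - i)%N.

(** Multiplication by q^k, just as [conv] is the product of power series. *)
Definition shift (k : nat) f (n : nat) : R :=
  if (k <= n)%N then f (n - k)%N else 0.

Lemma eq_conv f f' g g' : f =1 f' -> g =1 g' -> conv f g =1 conv f' g'.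
Proof. by move=> ff gg n; apply: eq_bigr => i _; rewrite ff gg. Qed.

Lemma eq_shift k f f' : f =1 f' -> shift k f =1 shift k f'.
Proof. by move=> ff n; rewrite /shift ff. Qed.

Lemma shiftD k f g n :
  shift k (fun m => f m + g m) n = shift k f n + shift k g n.
Proof. by rewrite /shift; case: ifP; rewrite ?addr0. Qed.

Lemma convC f g n : conv f g n = conv g f n.
Proof.
rewrite /conv (reindex_inj rev_ord_inj) /=; apply: eq_bigr => i _.
by rewrite subSS mulrC subKn // -ltnS.
Qed.

Lemma convDl f g h n :
  conv (fun m => f m + g m) h n = conv f h n + conv g h n.
Proof. by rewrite -big_split; apply: eq_bigr => i _; rewrite mulrDl. Qed.

Lemma convDr f g h n :
  conv f (fun m => g m + h m) n = conv f g n + conv f h n.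
Proof. by rewrite -big_split; apply: eq_bigr => i _; rewrite mulrDr. Qed.

Lemma conv_shiftl k f g n : conv (shift k f) g n = shift k (conv f g) n.
Proof.
rewrite /conv /shift; case: leqP => [le_kn|lt_nk]; last first.
  apply: big1 => i _; rewrite ifN ?mul0r // -ltnNge.
  exact: leq_ltn_trans (leq_ord i) lt_nk.
rewrite -(big_mkord xpredT
  (fun i => (if (k <= i)%N then f (i - k)%N else 0) * g (n - i)%N)).
rewrite (big_cat_nat (n := k)) //=; last exact: leqW.
rewrite big_nat_cond big1 ?add0r; last first.
  by move=> i /andP[/andP[_ ik] _]; rewrite leqNgt ik mul0r.
rewrite -{1}[k]add0n big_addn subSn // big_mkord.
apply: eq_bigr => i _; rewrite leq_addl addnK; congr (_ * g _).
by rewrite subnDA subnAC.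
Qed.

Lemma conv_shiftr k f g n : conv f (shift k g) n = shift k (conv f g) n.
Proof. by rewrite convC conv_shiftl; apply: eq_shift => m; rewrite convC. Qed.

End Convolution.

(** * The identity for bounded parts *)

Definition podZ (k n : nat) : int := (pod_le k n)%:Z.
(** The coefficients of A_k(-q). *)
Definition pod_signed (k n : nat) : int := (-1) ^+ n * podZ k n.
Definition overZ (k n : nat) : int := (over_le k n)%:Z.
Definition over_plainZ (k n : nat) : int := (over_plain_le k n)%:Z.

Lemma podZS k n :
  podZ k.+1 n = podZ k n + shift k.+1 (podZ (if odd k then k.+1 else k)) n.
Proof. by rewrite /podZ pod_leS /shift; case: ifP. Qed.

Lemma pod_signedS k n :
  pod_signed k.+1 n = pod_signed k n +
    (-1) ^+ k.+1 * shift k.+1 (pod_signed (if odd k then k.+1 else k)) n.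
Proof.
rewrite /pod_signed podZS mulrDr; congr (_ + _).
rewrite /shift; case: leqP => [_|lt_kn]; first by rewrite !mulr0.
by rewrite mulrA -exprD subnKC.
Qed.

Lemma podZ_eq_conv k : podZ k =1 conv (pod_signed k) (overZ k).
Proof.
elim: k => [|k IH] n.
  rewrite /conv big_ord_recl big1 => [|i _]; last first.
    by rewrite /pod_signed /podZ pod_le0 /= mulr0 mul0r.
  by rewrite /pod_signed /podZ /overZ over_le0 !pod_le0 subn0 !mul1r addr0.
case ko: (odd k).
  have CE : overZ k.+1 =1 overZ k by move=> m; rewrite /overZ over_leS_even.
  have BE m : pod_signed k.+1 m = pod_signed k m + shift k.+1 (pod_signed k.+1) m.
    by rewrite pod_signedS ko -signr_odd /= ko mul1r.
  (* Here q^(k+1) keeps its sign under q -> -q. Instead of dividing by 1 - q^(k+1), strong induction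
     on [n] handles the shifted term, whose index is [n - k.+1]. *)
  elim/ltn_ind: n => n IHn.
  rewrite podZS ko IH (eq_conv BE CE) convDl.
  congr (_ + _); rewrite conv_shiftl /shift; case: ifP => // lt_kn.
  rewrite IHn ?ltn_subrL ?(leq_trans _ lt_kn) //.
  exact: (eq_conv (fun=> erefl) CE).
(* With [s] standing for q^(k+1), the new product is (1 - s) B (1 + s) T. Since (1 - s) T = C_k, it
   equals (1 + s) B C_k = (1 + s) A_k = A_(k+1). *)
pose s := shift k.+1 : (nat -> int) -> _; pose B := pod_signed k.
pose T := over_plainZ k.+1.
have BE m : pod_signed k.+1 m = B m + - s B m.
  by rewrite pod_signedS ko -signr_odd /= ko mulN1r.
have CE m : overZ k.+1 m = T m + s T m.
  by rewrite /overZ over_le_odd /= ?ko // /s /shift /T /over_plainZ; case: ifP.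
have TE m : T m = overZ k m + s T m.
  by rewrite /T /over_plainZ over_plain_leS ?ko // /s /shift; case: ifP.
have BT : conv B T =1 fun m => conv B (overZ k) m + s (conv B T) m.
  by move=> m; rewrite (eq_conv (fun=> erefl) TE) convDr conv_shiftr.
have BsC m : conv B (overZ k.+1) m = conv B T m + s (conv B T) m.
  by rewrite (eq_conv (fun=> erefl) CE) convDr conv_shiftr.
have -> : conv (pod_signed k.+1) (overZ k.+1) n =
    conv B (overZ k.+1) n - s (conv B (overZ k.+1)) n.
  rewrite /s -conv_shiftl /conv -sumrB; apply: eq_bigr => i _.
  by rewrite BE mulrBl.
have sE f g : f =1 g -> s f n = s g n by move=> fg; exact: eq_shift.
have sD f g : s (fun m => f m + g m) n = s f n + s g n by exact: shiftD.
rewrite podZS ko -/(s _ n) IH (sE _ _ IH) (sE _ _ BsC) sD BsC.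
rewrite (BT n) (sE _ _ BT) sD; ring.
Qed.

(** * Removing the bound on parts *)

Local Open Scope classical_set_scope.

Theorem theorem4p7 (n : nat) :
  (pod n)%:Z =
  \sum_(j \in [set: nat]) (-1) ^+ j * (pod j)%:Z * (po_bar (n%:Z - j%:Z))%:Z.
Proof.
have po0 j : (n < j)%N -> po_bar (n%:Z - j%:Z) = 0%N.
  move=> lt_nj; have -> : n%:Z - j%:Z = Negz (j - n).-1 by lia.
  by [].
(* Terms with [j > n] vanish, which turns the sum over all naturals into a finite convolution. *)
rewrite -(fsbig_widen `I_n.+1); first last.
- by move=> j [_ /negP]; rewrite -leqNgt => /po0 /= ->; rewrite mulr0.
- by [].
(* At [k = n] the bound is vacuous for every size [i] and [n - i] that occurs. *)
rewrite -(pod_le_pod (leqnn n)) -/(podZ n n) podZ_eq_conv -fsbig_ord.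
apply: eq_bigr => i _; have le_in : (i <= n)%N := leq_ord i.
rewrite /pod_signed /podZ /overZ pod_le_pod // over_le_over ?leq_subr //.
by rewrite subzn.
Qed.
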